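(* Let $R$ be a ring. If $\varinjlim\mathcal P_1=\mathcal F_1$, then $\varinjlim\mathcal F_1^{\mathrm{fp}}=\mathcal F_1$.
   Context: $R$ is an associative ring with unit and modules are unital. $\mathcal F_1$ (resp. $\mathcal P_1$) is the class of right $R$-modules of flat (resp. projective) dimension at most $1$; $\mathcal F_1^{\mathrm{fp}}$ is the subclass of finitely presented modules in $\mathcal F_1$. For a class $\mathcal C$ of right modules, $\varinjlim\mathcal C$ is the class of all modules that are direct limits of direct systems (over directed sets) of modules in $\mathcal C$. *)

(* Defs.v *)
From HB Require Import structures.
From mathcomp Require Import all_boot all_order all_algebra.
From mathcomp Require Import boolp.
From mathcomp Require Import freeg.

Set Implicit Arguments.
Unset Strict Implicit.
Unset Printing Implicit Defensive.

Import Order.TTheory GRing.Theory.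
Local Open Scope ring_scope.
Local Open Scope quotient_scope.

(* MathComp modules are left modules.  A right module over R is a left module
   over the converse ring R^c: m r is written (r : R^c) *: m. *)
Notation rmodType R := (lmodType (R : pzRingType)^c).

Section Tensor.
Variables (R : pzRingType) (M : rmodType R) (N : lmodType R).

(* The subgroup of the free abelian group on M * N by which one divides to get
   the tensor product of M and N over R. *)
Inductive tensor_null : {freeg (M * N) / int} -> Prop :=
| tensor_null0 : tensor_null 0
| tensor_nullB x y : tensor_null x -> tensor_null y -> tensor_null (x - y)
| tensor_nullDl m m' n :
    tensor_null (<< (m + m', n) >> - << (m, n) >> - << (m', n) >>)
| tensor_nullDr m n n' :
    tensor_null (<< (m, n + n') >> - << (m, n) >> - << (m, n') >>)
| tensor_nullM m (r : R) n :
    tensor_null (<< ((r : R^c) *: m, n) >> - << (m, r *: n) >>).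

Definition tensor_nullb : {freeg (M * N) / int} -> bool :=
  fun x => `[< tensor_null x >].

Lemma tensor_null_zmod_closed : zmod_closed tensor_nullb.
Proof.
split=> [|x y /asboolP x0 /asboolP y0]; apply/asboolP.
- exact: tensor_null0.
- exact: tensor_nullB.
Qed.

HB.instance Definition _ :=
  GRing.isZmodClosed.Build _ tensor_nullb tensor_null_zmod_closed.

Definition tensor : zmodType :=
  {ideal_quot GRing.ZmodClosed.clone {freeg (M * N) / int} tensor_nullb _}.

Definition tensor_pure (m : M) (n : N) : tensor := \pi << (m, n) >>.

Lemma tensor_piP (x y : {freeg (M * N) / int}) :
  \pi_tensor x = \pi_tensor y <-> tensor_null (x - y).
Proof.
rewrite (rwP eqP) -Quotient.idealrBE.
by split=> [/asboolP|?]; last exact/asboolP.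
Qed.

Lemma tensor_piD : {morph \pi_tensor : x y / x + y}.
Proof. by move=> x y; rewrite !piE. Qed.

Lemma tensor_piB : {morph \pi_tensor : x y / x - y}.
Proof. by move=> x y; rewrite !piE. Qed.

End Tensor.

Section TensorMap.
Variables (R : pzRingType) (M : rmodType R) (A B : lmodType R).
Variable (f : {linear A -> B}).

Definition freeg_tensor_map : {freeg (M * A) / int} -> {freeg (M * B) / int} :=
  fglift (fun z => << (z.1, f z.2) >>).

(* The homomorphism id_M (x) f. *)
Definition tensor_map (x : tensor M A) : tensor M B :=
  \pi_(tensor M B) (freeg_tensor_map (repr x)).

Lemma freeg_tensor_mapB : {morph freeg_tensor_map : x y / x - y}.
Proof. exact: lift_is_additive. Qed.

Lemma freeg_tensor_mapU m a : freeg_tensor_map << (m, a) >> = << (m, f a) >>.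
Proof. by rewrite /freeg_tensor_map liftU scale1r. Qed.

Lemma tensor_null_map x : tensor_null x -> tensor_null (freeg_tensor_map x).
Proof.
elim=> {x} [|x y _ IHx _ IHy|m m' n|m n n'|m r n].
- by rewrite -(subrr 0) freeg_tensor_mapB subrr; apply: tensor_null0.
- by rewrite freeg_tensor_mapB; apply: tensor_nullB.
- by rewrite !freeg_tensor_mapB !freeg_tensor_mapU; apply: tensor_nullDl.
- rewrite !freeg_tensor_mapB !freeg_tensor_mapU linearD.
  exact: tensor_nullDr.
- rewrite !freeg_tensor_mapB !freeg_tensor_mapU linearZ.
  exact: tensor_nullM.
Qed.

Lemma tensor_map_pi x :
  tensor_map (\pi_(tensor M A) x) = \pi_(tensor M B) (freeg_tensor_map x).
Proof.
apply/tensor_piP; rewrite -freeg_tensor_mapB; apply: tensor_null_map.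
by apply/tensor_piP; rewrite reprK.
Qed.

Lemma tensor_mapE m a : tensor_map (tensor_pure m a) = tensor_pure m (f a).
Proof. by rewrite /tensor_pure tensor_map_pi freeg_tensor_mapU. Qed.

Lemma tensor_map_is_zmod_morphism : zmod_morphism tensor_map.
Proof.
move=> x y; rewrite -[x]reprK -[y]reprK -tensor_piB !tensor_map_pi.
by rewrite freeg_tensor_mapB tensor_piB.
Qed.

HB.instance Definition _ := GRing.isZmodMorphism.Build (tensor M A)
  (tensor M B) tensor_map tensor_map_is_zmod_morphism.

End TensorMap.

Arguments tensor_map {R} M {A B} f x.

Definition flat (R : pzRingType) (M : rmodType R) : Prop :=
  forall (A B : lmodType R) (f : {linear A -> B}),
    injective f -> injective (tensor_map M f).

Section Modules.
Variable S : pzRingType.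

Definition surjective (A B : Type) (f : A -> B) : Prop :=
  forall y, exists x, f x = y.

Definition exact_at (A B C : lmodType S)
    (f : {linear A -> B}) (g : {linear B -> C}) : Prop :=
  forall y, g y = 0 <-> exists x, f x = y.

Definition short_exact (A B C : lmodType S)
    (f : {linear A -> B}) (g : {linear B -> C}) : Prop :=
  [/\ injective f, exact_at f g & surjective g].

Definition projective (P : lmodType S) : Prop :=
  forall (A B : lmodType S) (g : {linear A -> B}) (h : {linear P -> B}),
    surjective g -> exists h' : {linear P -> A}, forall x, g (h' x) = h x.

Definition finitely_presented (M : lmodType S) : Prop :=
  exists (m n : nat) (f : {linear 'rV[S]_m -> 'rV[S]_n})
         (g : {linear 'rV[S]_n -> M}),
    exact_at f g /\ surjective g.

Record direct_system (d : Order.disp_t) (I : preorderType d) := DirectSystem {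
  ds_obj : I -> lmodType S;
  ds_map : forall i j, (i <= j)%O -> {linear ds_obj i -> ds_obj j};
  ds_map_id : forall i (ii : (i <= i)%O) x, ds_map ii x = x;
  ds_map_comp : forall i j k (ij : (i <= j)%O) (jk : (j <= k)%O)
    (ik : (i <= k)%O) x, ds_map jk (ds_map ij x) = ds_map ik x
}.

Definition directed (d : Order.disp_t) (I : preorderType d) : Prop :=
  inhabited I /\ forall i j : I, exists k, (i <= k)%O /\ (j <= k)%O.

Definition is_cocone (d : Order.disp_t) (I : preorderType d)
    (D : direct_system I) (L : lmodType S)
    (u : forall i, {linear ds_obj D i -> L}) : Prop :=
  forall i j (ij : (i <= j)%O) x, u j (ds_map D ij x) = u i x.

Definition is_direct_limit (d : Order.disp_t) (I : preorderType d)
    (D : direct_system I) (L : lmodType S)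
    (u : forall i, {linear ds_obj D i -> L}) : Prop :=
  is_cocone u /\
  forall (N : lmodType S) (v : forall i, {linear ds_obj D i -> N}),
    is_cocone v ->
    exists h : {linear L -> N},
      (forall i x, h (u i x) = v i x) /\
      forall h' : {linear L -> N},
        (forall i x, h' (u i x) = v i x) -> h' =1 h.

Definition module_class := lmodType S -> Prop.

Definition lim_class (C : module_class) : module_class := fun L =>
  exists (d : Order.disp_t) (I : preorderType d) (D : direct_system I)
         (u : forall i, {linear ds_obj D i -> L}),
    [/\ directed I, forall i, C (ds_obj D i) & is_direct_limit u].

(* The modules M having a resolution 0 -> X1 -> X0 -> M -> 0 with X0, X1 in
   C. *)
Definition dim_le1 (C : module_class) : module_class := fun M =>
  exists (X1 X0 : lmodType S)
         (f : {linear X1 -> X0}) (g : {linear X0 -> M}),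
    [/\ C X1, C X0 & short_exact f g].

Definition same_class (C D : module_class) : Prop := forall M, C M <-> D M.

End Modules.

Definition F1 (R : pzRingType) : module_class R^c := dim_le1 (@flat R).
Definition P1 (R : pzRingType) : module_class R^c := dim_le1 (@projective R^c).
Definition F1fp (R : pzRingType) : module_class R^c :=
  fun M => finitely_presented M /\ F1 M.

(* Main.v *)
From HB Require Import structures.
Require Import Defs.
From mathcomp Require Import all_boot all_order all_algebra.
From mathcomp Require Import boolp.

(* Modules of projective dimension at most 1 are closed under retracts.  A
   finitely presented M in F1 = lim P1 is a retract of a module in P1, because
   id_M factors through a term of the direct system; so F1fp is contained in P1
   and lim F1fp in lim P1 = F1.

   Conversely, every map from a finitely presented module to a module in lim P1
   factors through some Z in P1, and then through a finitely presented module in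
   P1: by Eilenberg's swindle Z has a resolution 0 -> V1 -> V0 -> Z -> 0 in which
   every finite subset of V1 or V0 lies in a free submodule of finite rank, and
   one takes the cokernel of a large enough restriction to such submodules.  By
   Lenzing's criterion M is then a direct limit of finitely presented modules in
   P1, and P1 is contained in lim P1 = F1. *)

Set Implicit Arguments.
Unset Strict Implicit.
Unset Printing Implicit Defensive.

Import Order.TTheory GRing.Theory.
Local Open Scope ring_scope.
Local Open Scope quotient_scope.

(** * Products, submodules and quotients of modules *)

Section DependentProduct.
Variables (S : pzRingType) (I : Type) (V : I -> lmodType S).

(** Serves twice: with the constant family [S^o] it holds the coordinates of a free module, with the
    terms of a direct system it holds families of elements to be compared for large indices. *)
Definition dep_prod : Type := forall i, V i.

HB.instance Definition _ := gen_eqMixin dep_prod.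
HB.instance Definition _ := gen_choiceMixin dep_prod.

Let opp (x : dep_prod) : dep_prod := fun i => - x i.
Let add (x y : dep_prod) : dep_prod := fun i => x i + y i.
Let scale a (x : dep_prod) : dep_prod := fun i => a *: x i.

Fact dep_prod_addA : associative add.
Proof. by move=> x y z; apply: functional_extensionality_dep => i; apply: addrA. Qed.
Fact dep_prod_addC : commutative add.
Proof. by move=> x y; apply: functional_extensionality_dep => i; apply: addrC. Qed.
Fact dep_prod_add0 : left_id (fun i => 0) add.
Proof. by move=> x; apply: functional_extensionality_dep => i; apply: add0r. Qed.
Fact dep_prod_addN : left_inverse (fun i => 0) opp add.
Proof. by move=> x; apply: functional_extensionality_dep => i; apply: addNr. Qed.

HB.instance Definition _ := GRing.isZmodule.Build dep_prod
  dep_prod_addA dep_prod_addC dep_prod_add0 dep_prod_addN.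

Fact dep_prod_scaleA a b x : scale a (scale b x) = scale (a * b) x.
Proof. by apply: functional_extensionality_dep => i; apply: scalerA. Qed.
Fact dep_prod_scale1 : left_id 1 scale.
Proof. by move=> x; apply: functional_extensionality_dep => i; apply: scale1r. Qed.
Fact dep_prod_scaleDr : right_distributive scale +%R.
Proof. by move=> a x y; apply: functional_extensionality_dep => i; apply: scalerDr. Qed.
Fact dep_prod_scaleDl x : {morph scale^~ x : a b / a + b}.
Proof. by move=> a b; apply: functional_extensionality_dep => i; apply: scalerDl. Qed.

HB.instance Definition _ := GRing.Zmodule_isLmodule.Build S dep_prod
  dep_prod_scaleA dep_prod_scale1 dep_prod_scaleDr dep_prod_scaleDl.

Lemma dep_prod_sumE J (r : seq J) (G : J -> dep_prod) i :
  (\sum_(k <- r) G k) i = \sum_(k <- r) G k i.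
Proof. exact: (big_morph (fun x : dep_prod => x i)). Qed.

End DependentProduct.

Definition is_submodule (S : pzRingType) (V : lmodType S) (W : V -> Prop) :=
  W 0 /\ forall a x y, W x -> W y -> W (a *: x + y).

Section Submodule.
Variables (S : pzRingType) (V : lmodType S) (W : V -> Prop).
Hypothesis subW : is_submodule W.

(** The proof is an argument of the predicate so that the closure instance below can be inferred
    from the predicate alone. *)
Definition submodule_pred of is_submodule W : {pred V} := fun x => `[< W x >].

Fact submodule_pred_closed : submod_closed (submodule_pred subW).
Proof.
case: subW => W0 WZ; split=> [|a x y /asboolP Wx /asboolP Wy].
  exact/asboolP.
exact/asboolP/WZ.
Qed.

HB.instance Definition _ :=
  GRing.isSubmodClosed.Build S V (submodule_pred subW)
    submodule_pred_closed.

Record submodule_type :=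
  SubmoduleType { submodule_val : V; _ : submodule_val \in submodule_pred subW }.
HB.instance Definition _ := [isSub for submodule_val].
HB.instance Definition _ := [Choice of submodule_type by <:].
HB.instance Definition _ := [SubChoice_isSubLmodule of submodule_type by <:].

Definition quotient_type : Type :=
  {ideal_quot GRing.ZmodClosed.clone V (submodule_pred subW) _}.
HB.instance Definition _ := GRing.Zmodule.on quotient_type.

Definition quotient_pi (x : V) : quotient_type :=
  \pi_{ideal_quot GRing.ZmodClosed.clone V (submodule_pred subW) _} x.
Definition quotient_repr (x : quotient_type) : V :=
  repr (x : {ideal_quot GRing.ZmodClosed.clone V (submodule_pred subW) _}).

Fact quotient_reprK : cancel quotient_repr quotient_pi.
Proof. exact: reprK. Qed.

Fact quotient_piP x y : quotient_pi x = quotient_pi y <-> W (x - y).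
Proof.
rewrite (rwP eqP) -Quotient.idealrBE.
by split=> [/asboolP|?]; last exact/asboolP.
Qed.

Fact quotient_piD : {morph quotient_pi : x y / x + y}.
Proof. by move=> x y; rewrite /quotient_pi !piE. Qed.

Let scale a (x : quotient_type) : quotient_type :=
  quotient_pi (a *: quotient_repr x).

Fact quotient_piZ a x : quotient_pi (a *: x) = scale a (quotient_pi x).
Proof.
have [W0 WZ] := subW; apply/quotient_piP; rewrite -scalerBr -[_ *: _]addr0.
by apply: WZ => //; apply/quotient_piP; rewrite quotient_reprK.
Qed.

Fact quotient_scaleA a b x : scale a (scale b x) = scale (a * b) x.
Proof. by rewrite -[x]quotient_reprK -!quotient_piZ scalerA. Qed.
Fact quotient_scale1 : left_id 1 scale.
Proof. by move=> x; rewrite -[x]quotient_reprK -!quotient_piZ scale1r. Qed.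
Fact quotient_scaleDr : right_distributive scale +%R.
Proof.
move=> a x y; rewrite -[x]quotient_reprK -[y]quotient_reprK.
by rewrite -quotient_piD -!quotient_piZ scalerDr quotient_piD.
Qed.
Fact quotient_scaleDl x : {morph scale^~ x : a b / a + b}.
Proof.
move=> a b; rewrite -[x]quotient_reprK.
by rewrite -!quotient_piZ scalerDl quotient_piD.
Qed.

HB.instance Definition _ := GRing.Zmodule_isLmodule.Build S quotient_type
  quotient_scaleA quotient_scale1 quotient_scaleDr quotient_scaleDl.

Fact quotient_pi_linear : linear quotient_pi.
Proof. by move=> a x y; rewrite quotient_piD quotient_piZ. Qed.

HB.instance Definition _ :=
  GRing.isLinear.Build S V quotient_type *:%R quotient_pi quotient_pi_linear.

End Submodule.

(** Bundles a linear map defined in the middle of a proof; it is then known only up to pointwise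
    equality. *)
Lemma ex_linear (S : pzRingType) (U V : lmodType S) (f : U -> V) :
  linear f -> exists g : {linear U -> V}, g =1 f.
Proof.
move=> lin_f.
pose c := GRing.isLinear.Build S U V *:%R f lin_f.
by exists (HB.pack_for {linear U -> V} f c).
Qed.

Lemma submodule_ex (S : pzRingType) (V : lmodType S) (W : V -> Prop) :
  is_submodule W ->
  exists (U : lmodType S) (i : {linear U -> V}),
    injective i /\ forall x, W x <-> exists y, i y = x.
Proof.
move=> subW; exists (submodule_type subW).
have [i iE] : exists i : {linear submodule_type subW -> V},
    i =1 @submodule_val _ _ _ subW.
  by apply: ex_linear => a x y; apply: (linearP (\val : submodule_type subW -> V)).
exists i; split=> [x y|x].
  by rewrite !iE; apply: val_inj.
split=> [Wx|[y <-]]; last by rewrite iE; apply/asboolP; apply: (valP y).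
by exists (SubmoduleType (asboolT Wx) : submodule_type subW); rewrite iE.
Qed.

Lemma quotient_ex (S : pzRingType) (V : lmodType S) (W : V -> Prop) :
  is_submodule W ->
  exists (Q : lmodType S) (p : {linear V -> Q}),
    surjective p /\ forall x, p x = 0 <-> W x.
Proof.
move=> subW; exists (quotient_type subW), (@quotient_pi _ _ _ subW).
split=> [y|x].
  by exists (quotient_repr y); apply: quotient_reprK.
by rewrite -(linear0 (@quotient_pi _ _ _ subW)) quotient_piP subr0.
Qed.

(** * Lifting and factoring linear maps, projectivity, retracts *)

Section LinearMaps.
Variable S : pzRingType.
Implicit Types A K M N U V W : lmodType S.

Lemma linear_injP U V (f : {linear U -> V}) :
  (forall x, f x = 0 -> x = 0) -> injective f.
Proof.
by move=> f0 x y fxy; apply/subr0_eq/f0; rewrite linearB /= fxy subrr.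
Qed.

Lemma linear_lift_inj A U V (i : {linear U -> V}) (f : {linear A -> V}) :
  injective i -> (forall x, exists y, i y = f x) ->
  exists g : {linear A -> U}, forall x, i (g x) = f x.
Proof.
move=> i_inj /choice[g gE].
have [g' g'E] : exists g' : {linear A -> U}, g' =1 g.
  by apply: ex_linear => a x y; apply: i_inj; rewrite linearP !gE linearP.
by exists g' => x; rewrite g'E.
Qed.

(** A set-theoretic section of [p] suffices: since [f] kills the kernel of [p], its composite with
    the section is independent of choices, hence linear. *)
Lemma linear_factor U V W (p : {linear U -> V}) (f : {linear U -> W}) :
  surjective p -> (forall x, p x = 0 -> f x = 0) ->
  exists g : {linear V -> W}, forall x, g (p x) = f x.
Proof.
move=> /choice[s sK] pf.
have fE x y : p x = p y -> f x = f y.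
  by move=> pxy; apply/subr0_eq; rewrite -linearB pf // linearB /= pxy subrr.
have [g gE] : exists g : {linear V -> W}, g =1 f \o s.
  apply: ex_linear => a x y /=; rewrite -linearP; apply: fE.
  by rewrite linearP !sK.
by exists g => x; rewrite gE; apply: fE; rewrite sK.
Qed.

Lemma ex_linear_rV n V (v : 'I_n -> V) :
  exists f : {linear 'rV[S]_n -> V}, forall i, f (delta_mx 0 i) = v i.
Proof.
have [f fE] : exists f : {linear 'rV[S]_n -> V},
    f =1 fun x => \sum_i x 0 i *: v i.
  apply: ex_linear => a x y; rewrite scaler_sumr -big_split /=.
  by apply: eq_bigr => i _; rewrite !mxE scalerDl scalerA.
exists f => i; rewrite fE (bigD1 i) //= mxE !eqxx scale1r big1 ?addr0 // => j.
by rewrite mxE eqxx /= eq_sym => /negPf ->; rewrite scale0r.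
Qed.

Lemma linear_rV_eq n V (f g : {linear 'rV[S]_n -> V}) :
  (forall i, f (delta_mx 0 i) = g (delta_mx 0 i)) -> f =1 g.
Proof.
move=> fg x; rewrite [x]row_sum_delta !linear_sum.
by apply: eq_bigr => i _; rewrite !linearZ /= fg.
Qed.

Lemma projective_rV n : projective 'rV[S]_n.
Proof.
move=> A B g h /choice[s sK].
have [h' h'E] := ex_linear_rV (fun i => s (h (delta_mx 0 i))).
exists h'; apply: (@linear_rV_eq n B (g \o h') h) => i /=.
by rewrite h'E sK.
Qed.

(* If 0 -> Q -> P -> N -> 0 is a projective resolution and M is a retract of N,
   then the kernel of P -> N -> M is a retract of P * Q. *)
Lemma dim_le1_retract M N (s : {linear M -> N}) (r : {linear N -> M}) :
  cancel s r -> dim_le1 (@projective S) N -> dim_le1 (@projective S) M.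
Proof.
move=> sK [Q [P [f [g [prQ prP [f_inj fgE g_surj]]]]]].
pose rg : {linear P -> M} := r \o g.
have rg_surj : surjective rg.
  by move=> x; have [y yE] := g_surj (s x); exists y; rewrite /= yE sK.
have subK : is_submodule (fun x => rg x = 0).
  split=> [|a x y x0 y0]; first exact: linear0.
  by rewrite linearP x0 y0 scaler0 addr0.
have [K [k [k_inj kE]]] := submodule_ex subK.
have rgk x : r (g (k x)) = 0 by apply/kE; exists x.
exists K, P, k, rg; split=> //.
(* Since [g (a x) = s (r (g x))], the map [a] sends K into the image of Q, and [x - a x] always lies
   in K because [r \o s] is the identity. The first fact gives [a1], the second [c]. *)
have [a aE] := prP _ _ g (s \o rg) g_surj.
have [a1 a1E] : exists a1 : {linear K -> Q}, forall x, f (a1 x) = a (k x).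
  apply: (@linear_lift_inj K Q P f (a \o k)) => // x /=.
  by apply/fgE; rewrite aE /= rgk linear0.
have gf x : g (f x) = 0 by apply/fgE; exists x.
have [b1 b1E] : exists b1 : {linear Q -> K}, forall x, k (b1 x) = f x.
  apply: linear_lift_inj => // x; apply/kE.
  by rewrite /= gf linear0.
have [c cE] : exists c : {linear P -> K}, forall x, k (c x) = x - a x.
  apply: (@linear_lift_inj P K P k (idfun \- a)) => // x; apply/kE.
  by rewrite linearB /= aE /= sK subrr.
have kc x : x = c (k x) + b1 (a1 x).
  by apply: k_inj; rewrite linearD cE b1E a1E subrK.
(* By [kc] a lift of [h] is obtained by lifting [h \o c] on P and [h \o b1] on Q separately. *)
move=> A B u h u_surj.
have [h1 h1E] := prP _ _ u (h \o c) u_surj.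
have [h2 h2E] := prQ _ _ u (h \o b1) u_surj.
exists ((h1 \o k) \+ (h2 \o a1)) => x /=.
by rewrite linearD h1E h2E /= -linearD -kc.
Qed.

End LinearMaps.

(** * Locally free modules and Eilenberg's swindle *)

Section LocallyFree.
Variable S : pzRingType.

(** The map [h] encodes a finite family in V, the injection [j] a free submodule of finite rank, and
    [d] the coordinates of the family in it. *)
Definition locally_free (V : lmodType S) := forall n (h : {linear 'rV[S]_n -> V}),
  exists p (j : {linear 'rV[S]_p -> V}) (d : {linear 'rV[S]_n -> 'rV[S]_p}),
    injective j /\ forall x, j (d x) = h x.

Lemma locally_free_iso (U V : lmodType S) (f : {linear U -> V}) :
  injective f -> surjective f -> locally_free U -> locally_free V.
Proof.
move=> f_inj f_surj lfU n h.
have [g gE] := linear_lift_inj f_inj (fun x => f_surj (h x)).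
have [p [j [d [j_inj jd]]]] := lfU n g.
exists p, (f \o j), d; split=> [|x /=]; first exact: inj_comp.
by rewrite jd gE.
Qed.

Definition finsupp (T : eqType) (x : T -> S) :=
  exists s : seq T, forall t, t \notin s -> x t = 0.

(** The free module on T is handled only through its coordinate map, whose image is the set of
    functions of finite support. *)
Definition free_coordinates (T : eqType) (F : lmodType S)
    (c : {linear F -> dep_prod (fun _ : T => S^o)}) :=
  injective c /\ forall x : T -> S, finsupp x <-> exists y, c y = x.

Lemma free_ex (T : eqType) : exists F c, @free_coordinates T F c.
Proof.
apply: submodule_ex; split=> [|a x y [s xs] [s' ys']]; first by exists [::].
exists (s ++ s') => t; rewrite mem_cat negb_or => /andP[ts ts'].
have -> : (a *: x + y) t = a * x t + y t by [].
by rewrite xs // ys' // mulr0 addr0.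
Qed.

Section FreeModule.
Variables (T : eqType) (F : lmodType S).
Variable c : {linear F -> dep_prod (fun _ : T => S^o)}.
Hypothesis freeF : free_coordinates c.

Lemma free_finsupp y : finsupp (c y).
Proof. by apply/freeF.2; exists y. Qed.

Lemma free_mk (x : T -> S) : finsupp x -> exists y, c y = x.
Proof. by move/freeF.2. Qed.

Lemma free_eq y z : (forall t, c y t = c z t) -> y = z.
Proof. by move=> yz; apply/freeF.1/functional_extensionality_dep. Qed.

Lemma free_common_support n (h : 'I_n -> F) :
  exists2 s : seq T, uniq s & forall i t, t \notin s -> c (h i) t = 0.
Proof.
have /choice[s sE] i := free_finsupp (h i).
exists (undup (flatten [seq s i | i <- enum 'I_n])); first exact: undup_uniq.
move=> i t; rewrite mem_undup => /flatten_mapP nt.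
by apply: sE; apply/negP => ti; apply: nt; exists i; rewrite ?mem_enum.
Qed.

(** The supports of finitely many vectors lie in one finite set [s], and the basis vectors indexed
    by [s] span a free submodule containing them. *)
Lemma locally_free_free : locally_free F.
Proof.
move=> n h.
have [s s_uniq sE] := free_common_support (fun i => h (delta_mx 0 i)).
have /choice[b bE] (k : 'I_(size s)) :
    exists y, forall t, c y t = (t == tnth (in_tuple s) k)%:R.
  have [|y yE] := @free_mk (fun t => (t == tnth (in_tuple s) k)%:R).
    exists [:: tnth (in_tuple s) k] => t.
    by rewrite inE => /negPf ->.
  by exists y => t; rewrite yE.
have [j jE] := ex_linear_rV b.
have jt x t : c (j x) t = \sum_k x 0 k * (t == tnth (in_tuple s) k)%:R.
  rewrite [x in LHS]row_sum_delta !linear_sum /=.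
  rewrite dep_prod_sumE.
  apply: eq_bigr => k _; rewrite !linearZ /= jE.
  by rewrite -(bE k t).
have [d dE] := ex_linear_rV
  (fun i => \row_(k < size s) c (h (delta_mx 0 i)) (tnth (in_tuple s) k)).
(* As [s] has no repetitions, distinct indices give distinct basis vectors; this makes [j]
   injective. *)
have sk k k' : (tnth (in_tuple s) k == tnth (in_tuple s) k') = (k == k').
  by apply: inj_eq; apply/tuple_uniqP.
exists (size s), j, d; split.
  apply: linear_injP => x x0; apply/rowP => k; rewrite mxE.
  have /esym : c (j x) (tnth (in_tuple s) k) = 0 by rewrite x0 linear0.
  rewrite jt (bigD1 k) //= eqxx mulr1 big1 ?addr0 => [->//|k' k'k].
  by rewrite sk eq_sym (negPf k'k) mulr0.
apply: (@linear_rV_eq S n F (j \o d) h) => i /=; apply: free_eq => t.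
rewrite jt dE; under eq_bigr do rewrite mxE.
have [ts|ts] := boolP (t \in s); last first.
  rewrite sE // big1 // => k _; case: eqP => [tk|]; rewrite ?mulr0 //.
  by rewrite tk mem_tnth in ts.
have [k ->] : exists k, t = tnth (in_tuple s) k by apply/tnthP.
rewrite (bigD1 k) //= eqxx mulr1 big1 ?addr0 // => k' k'k.
by rewrite sk eq_sym (negPf k'k) mulr0.
Qed.

End FreeModule.

(** F is free on the underlying set of P, and the basis vector at t goes to t. *)
Lemma free_onto (P F : lmodType S) (c : {linear F -> dep_prod (fun _ : P => S^o)}) :
  free_coordinates c -> exists p : {linear F -> P}, surjective p.
Proof.
move=> freeF.
pose supp (x : F) (s : seq P) := uniq s /\ forall t, t \notin s -> c x t = 0.
(* The sum does not depend on the support chosen, so linearity can be checked over one support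
   common to all the vectors involved. *)
have suppU x s s' : supp x s -> supp x s' ->
    \sum_(t <- s) (c x t : S) *: t = \sum_(t <- s') (c x t : S) *: t.
  move=> [us xs] [us' xs'].
  have red r : \sum_(t <- r) (c x t : S) *: t =
      \sum_(t <- [seq t <- r | c x t != 0 :> S]) (c x t : S) *: t.
    rewrite big_filter; apply/esym/big_rmcond => t /negbNE/eqP ->.
    exact: scale0r.
  rewrite red [RHS]red; apply: perm_big; apply: uniq_perm; rewrite ?filter_uniq //.
  move=> t; rewrite !mem_filter; case: eqP => //= x0.
  by apply/idP/idP => _; apply: contra_notT x0; [apply: xs'|apply: xs].
have /choice[s sE] x : exists s, supp x s.
  have [s xs] := free_finsupp freeF x; exists (undup s).
  by split=> [|t]; rewrite ?undup_uniq // mem_undup; apply: xs.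
have [p pE] : exists p : {linear F -> P}, p =1 fun x => \sum_(t <- s x) (c x t : S) *: t.
  apply: ex_linear => a x y.
  pose r := undup (s (a *: x + y) ++ s x ++ s y).
  have sr z : {subset s z <= r} -> supp z r.
    move=> zr; split=> [|t tr]; first exact: undup_uniq.
    by apply: (sE z).2; apply: contra tr; apply: zr.
  rewrite !(suppU _ _ r) //; try by
    apply: sr => t; rewrite mem_undup !mem_cat => ->; rewrite ?orbT.
  rewrite scaler_sumr -big_split /=; apply: eq_bigr => t _.
  have -> : c (a *: x + y) t = a * c x t + c y t :> S by rewrite linearP.
  by rewrite scalerDl scalerA.
exists p => z.
have [|x xE] := @free_mk _ _ _ freeF (fun t => (t == z)%:R).
  by exists [:: z] => t; rewrite inE => /negPf ->.
exists x; rewrite pE (suppU x _ [:: z]) //; last first.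
  by split=> // t; rewrite inE xE => /negPf ->.
by rewrite big_seq1 xE eqxx scale1r.
Qed.

(** Q is a direct sum of countably many copies of F with components [k n]. Taking it to be the free
    module on [nat * T] makes it locally free at once. *)
Lemma eventually_zero_sequences_ex (T : eqType) (F : lmodType S)
    (c : {linear F -> dep_prod (fun _ : T => S^o)}) :
  free_coordinates c ->
  exists (Q : lmodType S) (k : nat -> {linear Q -> F}),
    [/\ locally_free Q, forall x y, (forall n, k n x = k n y) -> x = y &
      forall x : nat -> F,
        (exists N, forall n, (N <= n)%N -> x n = 0) <->
        exists y, forall n, k n y = x n].
Proof.
move=> freeF; have [Q [cQ freeQ]] := free_ex (nat * T)%type.
have /choice[k kE] n : exists k : {linear Q -> F},
    forall y t, c (k y) t = cQ y (n, t).
  have [u uE] : exists u : {linear Q -> dep_prod (fun _ : T => S^o)},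
      u =1 fun y t => cQ y (n, t).
    by apply: ex_linear => a x y; rewrite linearP.
  have [|k kE] := linear_lift_inj (f := u) freeF.1.
    move=> y; apply/freeF.2; have [s ys] := free_finsupp freeQ y.
    exists [seq z.2 | z <- s] => t ts; rewrite uE; apply: ys.
    by apply: contra ts => nts; apply/mapP; exists (n, t).
  by exists k => y t; rewrite kE uE.
exists Q, k; split; first exact: locally_free_free freeQ.
  by move=> x y xy; apply: (free_eq freeQ) => -[n t]; rewrite -!kE xy.
move=> x; split=> [[N xN]|[y yE]]; last first.
  have [s ys] := free_finsupp freeQ y.
  exists (\max_(z <- s) z.1).+1 => n; rewrite -yE => nN.
  apply: (free_eq freeF) => t; rewrite kE linear0; apply: ys.
  by apply: contraL nN => nts; rewrite -ltnNge ltnS (leq_bigmax_seq _ nts).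
have [s _ xs] := free_common_support freeF (fun i : 'I_N => x i).
have [|y yE] := @free_mk _ _ _ freeQ (fun z => c (x z.1) z.2).
  exists [seq (n, t) | n <- iota 0 N, t <- s] => -[n t] /= nt.
  have [nN|/xN->] := ltnP n N; last by rewrite linear0.
  apply: (xs (Ordinal nN)); apply: contra nt => ts.
  by apply/allpairsP; exists (n, t); rewrite mem_iota.
by exists y => n; apply: (free_eq freeF) => t; rewrite kE yE.
Qed.

(* Eilenberg's swindle: a sequence y in F = P + P' corresponds to the pair
   formed by the P-part of y 0 and the sequence pairing the P-part of y n.+1
   with the P'-part of y n. *)
Lemma locally_free_swindle (P F Q : lmodType S) (k : nat -> {linear Q -> F})
    (e : {linear P -> F}) (p : {linear F -> P}) :
  cancel e p -> locally_free Q -> (forall x y, (forall n, k n x = k n y) -> x = y) ->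
  (forall x : nat -> F,
     (exists N, forall n, (N <= n)%N -> x n = 0) <->
     exists y, forall n, k n y = x n) ->
  locally_free (P * Q)%type.
Proof.
move=> eK lfQ k_inj kP.
have kN y : exists N, forall n, (N <= n)%N -> k n y = 0.
  by apply/kP; exists y.
have /choice[w wE] y : exists z, forall n,
    k n z = e (p (k n.+1 y)) + (k n y - e (p (k n y))).
  apply/kP; have [N yN] := kN y; exists N => n Nn.
  by rewrite !yN ?leqW // !linear0 ?oppr0 ?addr0.
have [f fE] : exists f : {linear Q -> (P * Q)%type}, f =1 fun y => (p (k 0 y), w y).
  apply: ex_linear => a x y; congr pair; first by rewrite !linearP.
  pose g n : {linear Q -> F} := (e \o (p \o k n.+1)) \+ (k n \- (e \o (p \o k n))).
  have wg z n : k n (w z) = g n z by rewrite wE.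
  by apply: k_inj => n; rewrite linearP !wg linearP.
apply: (@locally_free_iso Q (P * Q)%type f) lfQ.
- apply: linear_injP => y; rewrite fE => -[y0 wy0].
  have wy n : e (p (k n.+1 y)) + (k n y - e (p (k n y))) = 0.
    by rewrite -wE wy0 linear0.
  (* Applying [p] to [wy] isolates the P-part of every entry of positive index; the P-part of entry
     0 is the first component of [f y]. *)
  have py n : p (k n y) = 0.
    case: n => // n; have /(congr1 p) := wy n.
    by rewrite linearD linearB !eK subrr addr0 linear0.
  apply: k_inj => n; have := wy n.
  by rewrite !py !linear0 add0r ?oppr0 addr0.
- move=> [z x].
  have [|y yE] := (kP (fun n => match n with
      | 0 => e z + (k 0 x - e (p (k 0 x)))
      | m.+1 => e (p (k m x)) + (k m.+1 x - e (p (k m.+1 x))) end)).1.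
    (* The P-parts of [x] move up by one place, so the preimage may vanish one step later than
       [x]. *)
    have [N xN] := kN x; exists N.+1 => -[//|n] Nn.
    by rewrite (xN n) // (xN n.+1) 1?ltnW // !linear0 ?oppr0 ?addr0.
  exists y; rewrite fE.
  have py n : p (k n.+1 y) = p (k n x).
    by rewrite yE linearD linearB !eK subrr addr0.
  congr pair; first by rewrite yE linearD linearB !eK subrr addr0.
  apply: k_inj => n; rewrite wE py; case: n => [|n].
    rewrite yE linearD linearB !eK subrr addr0.
    by rewrite [e z + _]addrC addrK addrC subrK.
  by rewrite py yE [e (p (k n x)) + _]addrC addrK addrC subrK.
Qed.

(** The same Q must be added to both terms of a resolution. Hence F is taken free onto [P1 * P0],
    which makes both modules direct summands of F. *)
Lemma locally_free_ex (P1 P0 : lmodType S) : projective P1 -> projective P0 ->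
  exists Q : lmodType S, locally_free (P1 * Q)%type /\ locally_free (P0 * Q)%type.
Proof.
move=> pr1 pr0; have [F [c freeF]] := free_ex (P1 * P0)%type.
have [p p_surj] := free_onto (P := (P1 * P0)%type) freeF.
have [Q [k [lfQ k_inj kP]]] := eventually_zero_sequences_ex freeF.
have [i1 i1E] : exists f : {linear P1 -> (P1 * P0)%type}, f =1 fun x => (x, 0).
  by apply: ex_linear => a x y; congr pair; rewrite //= scaler0 addr0.
have [i0 i0E] : exists f : {linear P0 -> (P1 * P0)%type}, f =1 fun x => (0, x).
  by apply: ex_linear => a x y; congr pair; rewrite //= scaler0 addr0.
have [e1 e1E] := pr1 _ _ p i1 p_surj.
have [e0 e0E] := pr0 _ _ p i0 p_surj.
exists Q; split.
- apply: (@locally_free_swindle P1 F Q k e1 (fst \o p)) => // x.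
  by rewrite /= e1E i1E.
- apply: (@locally_free_swindle P0 F Q k e0 (snd \o p)) => // x.
  by rewrite /= e0E i0E.
Qed.

End LocallyFree.

(** * Elementwise description of direct limits *)

Section DirectLimit.
Variables (S : pzRingType) (d : Order.disp_t) (I : preorderType d).
Variables (D : direct_system S I) (L : lmodType S).
Variable u : forall i, {linear ds_obj D i -> L}.
Hypothesis dirI : directed I.

Lemma directed_ub (s : seq I) : exists k, forall i, i \in s -> (i <= k)%O.
Proof.
have [[i0] dir] := dirI.
elim: s => [|i s [k sk]]; first by exists i0.
have [l [il kl]] := dir i k; exists l => j.
by rewrite inE => /predU1P[->//|/sk jk]; apply: le_trans kl.
Qed.

Lemma is_direct_limit_surj : is_direct_limit u -> forall z, exists i x, u i x = z.
Proof.
move=> [coc univ]; have [[i0] dir] := dirI.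
have subW : is_submodule (fun z => exists i x, u i x = z).
  split=> [|a _ _ [i [x <-]] [j [y <-]]]; first by exists i0, 0; rewrite linear0.
  have [k [ik jk]] := dir i j.
  by exists k, (a *: ds_map D ik x + ds_map D jk y); rewrite linearP !coc.
have [Q [p [_ pW]]] := quotient_ex subW.
(* The projection of L modulo the union of the images and the zero map induce the same cocone, so
   they coincide by uniqueness. *)
have [|h [_ h_uniq]] := univ Q (fun i => \0); first by [].
move=> z; apply/pW; rewrite (h_uniq p) => [|i x]; last by apply/pW; exists i, x.
by rewrite -(h_uniq \0).
Qed.

(* The transition maps form a cocone to the quotient of the product of the
   modules by the families that vanish eventually. *)
Lemma is_direct_limit_ker : is_direct_limit u ->
  forall i x, u i x = 0 -> exists k (ik : (i <= k)%O), ds_map D ik x = 0.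
Proof.
move=> [coc univ]; have [[i0] dir] := dirI.
have subW : is_submodule (fun x : dep_prod (ds_obj D) =>
    exists k, forall j, (k <= j)%O -> x j = 0).
  split=> [|a x y [k xk] [l yl]]; first by exists i0.
  have [m [km lm]] := dir k l; exists m => j mj.
  have -> : (a *: x + y) j = a *: x j + y j by [].
  by rewrite xk ?yl ?scaler0 ?addr0 //; apply: le_trans mj.
have [Q [p [_ pW]]] := quotient_ex subW.
have w_ex i : exists w : {linear ds_obj D i -> dep_prod (ds_obj D)},
    forall x j (ij : (i <= j)%O), w x j = ds_map D ij x.
  (* The default value 0 at indices not above [i] is harmless: only the values at large indices
     matter in Q. *)
  have [w wE] : exists w : {linear ds_obj D i -> dep_prod (ds_obj D)},
      w =1 fun x j => if @idP (i <= j)%O is ReflectT ij then ds_map D ij x else 0.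
    apply: ex_linear => a x y; apply: functional_extensionality_dep => j.
    have -> (f g : dep_prod (ds_obj D)) : (a *: f + g) j = a *: f j + g j by [].
    by case: {-}_ / idP => [ij|_]; rewrite ?linearP // scaler0 addr0.
  exists w => x j ij; rewrite wE; case: {-}_ / idP => [ij'|]; last by case.
  by rewrite (bool_irrelevance ij' ij).
pose w i := projT1 (cid (w_ex i)); have wE i := projT2 (cid (w_ex i)).
have [|h [hE _]] := univ Q (fun i => p \o w i).
  move=> i j ij x /=; apply/subr0_eq; rewrite -linearB; apply/pW.
  exists j => k jk.
  have -> (f g : dep_prod (ds_obj D)) : (f - g) k = f k - g k by [].
  rewrite !wE; first exact: le_trans jk.
  by move=> ik; rewrite (ds_map_comp ij jk ik) subrr.
move=> i x x0; have /esym := hE i x; rewrite x0 linear0 => /pW[k wk].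
have [l [il kl]] := dir i k; exists l, il.
by rewrite -wE; apply: wk.
Qed.

(** Every element of L comes from some stage, and two representatives agree at a later stage; hence
    a cocone takes the same value on both. *)
Lemma is_direct_limitP : is_cocone u ->
  (forall z, exists i x, u i x = z) ->
  (forall i x, u i x = 0 -> exists k (ik : (i <= k)%O), ds_map D ik x = 0) ->
  is_direct_limit u.
Proof.
move=> coc u_surj u_ker; have [_ dir] := dirI.
split=> // N v v_coc.
have uv i x j y : u i x = u j y -> v i x = v j y.
  have [k [ik jk]] := dir i j.
  rewrite -(coc _ _ ik) -(coc _ _ jk) -(v_coc _ _ ik) -(v_coc _ _ jk) => uxy.
  have [|l [kl xyl]] := u_ker k (ds_map D ik x - ds_map D jk y).
    by rewrite linearB /= uxy subrr.
  apply/subr0_eq; rewrite -linearB -(v_coc _ _ kl) xyl; exact: linear0.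
have h_ex z : exists y, forall i x, u i x = z -> v i x = y.
  have [j [y yz]] := u_surj z; exists (v j y) => i x xz.
  by apply: uv; rewrite xz.
have /choice[h0 h0E] := h_ex.
have [h hE] : exists h : {linear L -> N}, h =1 h0.
  apply: ex_linear => a z z'.
  have [i [x <-]] := u_surj z; have [j [y <-]] := u_surj z'.
  have [k [ik jk]] := dir i j.
  rewrite -(h0E _ i x erefl) -(h0E _ j y erefl) -(v_coc _ _ ik) -(v_coc _ _ jk).
  by rewrite -linearP; apply/esym/h0E; rewrite linearP !coc.
exists h; split=> [i x|h' h'E z]; first by rewrite hE; apply/esym/h0E.
by have [i [x <-]] := u_surj z; rewrite h'E hE; apply: h0E.
Qed.

End DirectLimit.

(** * Factoring maps out of finitely presented modules *)

Section Factorization.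
Variable S : pzRingType.

(* Every map to M from a finitely presented module 'rV_n / (r) factors through
   a module in C. *)
Definition factors_through (C : module_class S) (M : lmodType S) :=
  forall n (h : {linear 'rV[S]_n -> M}) (r : seq 'rV[S]_n),
    (forall x, x \in r -> h x = 0) ->
  exists (X : lmodType S) (a : {linear 'rV[S]_n -> X}) (b : {linear X -> M}),
    [/\ C X, forall x, x \in r -> a x = 0 & forall x, b (a x) = h x].

(** The images of the finitely many basis vectors lift to one stage [k], and the finitely many
    relations vanish at a later stage [m]. *)
Lemma lim_class_factors (C : module_class S) M :
  lim_class C M -> factors_through C M.
Proof.
move=> [d [I [D [u [dirI CD limu]]]]] n h r hr.
have [coc _] := limu.
have /choice[i] := fun l : 'I_n => is_direct_limit_surj dirI limu (h (delta_mx 0 l)).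
move=> i_ex; have [k ik] := directed_ub dirI [seq i l | l <- enum 'I_n].
have /choice[x xE] l : exists x, u k x = h (delta_mx 0 l).
  have [x <-] := i_ex l.
  have ilk : (i l <= k)%O by apply: ik; apply: map_f; rewrite mem_enum.
  by exists (ds_map D ilk x); rewrite coc.
have [a aE] := ex_linear_rV x.
have ua : forall y, u k (a y) = h y.
  by apply: (@linear_rV_eq S n M (u k \o a) h) => l /=; rewrite aE.
have [m [km ar]] : exists m (km : (k <= m)%O),
    forall y, y \in r -> ds_map D km (a y) = 0.
  elim: r hr => [|y r IHr] hr; first by exists k, (lexx k).
  have [z zr|m [km ar]] := IHr; first by apply: hr; rewrite inE zr orbT.
  have [|m' [mm' ay]] := is_direct_limit_ker dirI limu (i := m) (x := ds_map D km (a y)).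
    by rewrite coc ua hr ?mem_head.
  have km' := le_trans km mm'; exists m', km' => z.
  rewrite inE -(ds_map_comp km mm' km') => /predU1P[->//|/ar->].
  exact: linear0.
exists (ds_obj D m), (ds_map D km \o a), (u m); split=> // y /=.
by rewrite coc ua.
Qed.

(* A finite part of a projective resolution of Z, once the swindle has made its
   terms locally free, is a resolution by free modules of finite rank. *)
Lemma dim_le1_factors (Z : lmodType S) : dim_le1 (@projective S) Z ->
  forall n (h : {linear 'rV[S]_n -> Z}) (r : seq 'rV[S]_n),
    (forall x, x \in r -> h x = 0) ->
  exists (p q : nat) (f : {linear 'rV[S]_p -> 'rV[S]_q}), injective f /\
    forall (X : lmodType S) (g : {linear 'rV[S]_q -> X}), short_exact f g ->
    exists (a : {linear 'rV[S]_n -> X}) (b : {linear X -> Z}),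
      (forall x, x \in r -> a x = 0) /\ forall x, b (a x) = h x.
Proof.
move=> [Q1 [Q0 [i [g0 [pr1 pr0 [i_inj ig g_surj]]]]]] n h r hr.
have [Q [lf1 lf0]] := locally_free_ex pr1 pr0.
have [h1 h1E] := @projective_rV S n _ _ g0 h g_surj.
have [h0 h0E] : exists h0 : {linear 'rV[S]_n -> (Q0 * Q)%type},
    h0 =1 fun x => (h1 x, 0).
  by apply: ex_linear => a x y; congr pair; rewrite ?linearP //= scaler0 addr0.
(* Adding the identity of Q to [i] changes neither injectivity nor the cokernel Z, and makes both
   terms locally free. *)
have [j jE] : exists j : {linear (Q1 * Q)%type -> (Q0 * Q)%type},
    j =1 fun x => (i x.1, x.2).
  by apply: ex_linear => a x y; congr pair; rewrite linearP.
have j_inj : injective j.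
  by move=> [x x'] [y y']; rewrite !jE /= => -[/i_inj -> ->].
(* The relations die in Z, so their lifts come from elements [v] of [Q1 * Q]; the free submodule
   [j1] is chosen to contain these. *)
have /choice[v vE] (l : 'I_(size r)) : exists v, j v = h0 (tnth (in_tuple r) l).
  have [x xE] : exists x, i x = h1 (tnth (in_tuple r) l).
    by apply/ig; rewrite h1E hr // mem_tnth.
  by exists (x, 0); rewrite jE h0E xE.
have [f1 f1E] := ex_linear_rV v.
have [p [j1 [c [j1_inj j1c]]]] := lf1 _ f1.
(* Joining [h0] and [j \o j1] in one map yields a single free submodule [j0] containing both images;
   [f] and [a] are the two halves of [e]. *)
have [k kE] : exists k : {linear 'rV[S]_(n + p) -> (Q0 * Q)%type},
    k =1 fun x => h0 (lsubmx x) + j (j1 (rsubmx x)).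
  by apply: ex_linear => a x y; rewrite !linearP /= scalerDr addrACA.
have [q [j0 [e [j0_inj j0e]]]] := lf0 _ k.
have [f fE] : exists f : {linear 'rV[S]_p -> 'rV[S]_q}, f =1 fun x => e (row_mx 0 x).
  apply: ex_linear => a x y; rewrite -linearP; congr (e _).
  by rewrite scale_row_mx add_row_mx scaler0 addr0.
have [a aE] : exists a : {linear 'rV[S]_n -> 'rV[S]_q}, a =1 fun x => e (row_mx x 0).
  apply: ex_linear => b x y; rewrite -linearP; congr (e _).
  by rewrite scale_row_mx add_row_mx scaler0 addr0.
have j0f x : j0 (f x) = j (j1 x).
  by rewrite fE j0e kE row_mxKl row_mxKr linear0 add0r.
have j0a x : j0 (a x) = h0 x.
  by rewrite aE j0e kE row_mxKl row_mxKr !linear0 addr0.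
have af (l : 'I_(size r)) : a (tnth (in_tuple r) l) = f (c (delta_mx 0 l)).
  by apply: j0_inj; rewrite j0a j0f j1c f1E vE.
exists p, q, f; split.
  by move=> x y fxy; apply/j1_inj/j_inj; rewrite -!j0f fxy.
move=> X g [_ fg gX_surj].
have [|b bE] := linear_factor (f := g0 \o (fst \o j0)) gX_surj.
  move=> x /fg[y <-] /=; rewrite j0f jE /=.
  by apply/ig; exists (j1 y).1.
exists (g \o a), b; split=> [x /(tnthP (in_tuple r))[l ->]|x] /=.
  by rewrite af; apply/fg; exists (c (delta_mx 0 l)).
by rewrite bE /= j0a h0E h1E.
Qed.

End Factorization.

(** * Finite presentations *)

Section FinitePresentation.
Variable S : pzRingType.

(** The relations enter through the universal property they impose on maps out of X, which is the
    form in which factorizations are transferred to X. *)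
Definition presentation (X : lmodType S) n (p : {linear 'rV[S]_n -> X})
    (r : seq 'rV[S]_n) :=
  [/\ surjective p, forall x, x \in r -> p x = 0 &
    forall (V : lmodType S) (a : {linear 'rV[S]_n -> V}),
      (forall x, x \in r -> a x = 0) ->
      exists a' : {linear X -> V}, forall x, a' (p x) = a x].

Lemma finitely_presented_presentation (X : lmodType S) :
  finitely_presented X -> exists n p r, @presentation X n p r.
Proof.
move=> [m [n [f [p [fp p_surj]]]]].
exists n, p, [seq f (delta_mx 0 i) | i <- enum 'I_m]; split=> //.
  by move=> _ /mapP[i _ ->]; apply/fp; eexists.
move=> V a ar; apply: linear_factor => // x /fp[y <-].
apply: (@linear_rV_eq S m V (a \o f) \0) => i /=.
by apply: ar; apply: map_f; rewrite mem_enum.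
Qed.

Lemma presentation_prod (X Y : lmodType S) n p r n' p' r' :
  @presentation X n p r -> @presentation Y n' p' r' ->
  exists p2 r2, @presentation (X * Y)%type (n + n') p2 r2.
Proof.
move=> [p_surj pr p_univ] [p'_surj pr' p'_univ].
have [p2 p2E] : exists p2 : {linear 'rV[S]_(n + n') -> (X * Y)%type},
    p2 =1 fun x => (p (lsubmx x), p' (rsubmx x)).
  by apply: ex_linear => a x y; rewrite !linearP.
exists p2, ([seq row_mx x 0 | x <- r] ++ [seq row_mx 0 x | x <- r']); split.
- move=> [x y]; have [z <-] := p_surj x; have [z' <-] := p'_surj y.
  by exists (row_mx z z'); rewrite p2E row_mxKl row_mxKr.
- move=> z; rewrite mem_cat p2E => /orP[]/mapP[x xr ->];
  by rewrite row_mxKl row_mxKr linear0 ?pr ?pr'.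
move=> V a ar.
have [l lE] : exists l : {linear 'rV[S]_n -> V}, l =1 fun x => a (row_mx x 0).
  apply: ex_linear => b x y; rewrite -linearP; congr (a _).
  by rewrite scale_row_mx add_row_mx scaler0 addr0.
have [l' l'E] : exists l : {linear 'rV[S]_n' -> V}, l =1 fun x => a (row_mx 0 x).
  apply: ex_linear => b x y; rewrite -linearP; congr (a _).
  by rewrite scale_row_mx add_row_mx scaler0 addr0.
have [|u uE] := p_univ V l.
  by move=> x xr; rewrite lE ar // mem_cat (map_f (row_mx^~ 0)).
have [|u' u'E] := p'_univ V l'.
  by move=> x xr; rewrite l'E ar // mem_cat orbC (map_f (row_mx 0)).
have [w wE] : exists w : {linear (X * Y)%type -> V}, w =1 fun z => u z.1 + u' z.2.
  by apply: ex_linear => b x y; rewrite !linearP /= scalerDr addrACA.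
exists w => x; rewrite wE p2E /= uE u'E lE l'E -linearD add_row_mx.
by rewrite addr0 add0r hsubmxK.
Qed.

End FinitePresentation.

(** * Lenzing's criterion *)

Section Lenzing.
Variables (S : pzRingType) (K : Type) (X : K -> lmodType S) (M : lmodType S).
Hypothesis X_fp : forall k, finitely_presented (X k).
Hypothesis M_factors : forall n (h : {linear 'rV[S]_n -> M}) (r : seq 'rV[S]_n),
    (forall x, x \in r -> h x = 0) ->
  exists k (a : {linear 'rV[S]_n -> X k}) (b : {linear X k -> M}),
    (forall x, x \in r -> a x = 0) /\ forall x, b (a x) = h x.

(** Lifts of the elements of [s] are appended to the relations of N; the map obtained on the free
    module then descends to N. *)
Lemma presented_factors (N : lmodType S) n p r : @presentation S N n p r ->
  forall (h : {linear N -> M}) (s : seq N), (forall x, x \in s -> h x = 0) ->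
  exists k (a : {linear N -> X k}) (b : {linear X k -> M}),
    (forall x, x \in s -> a x = 0) /\ forall x, b (a x) = h x.
Proof.
move=> [p_surj pr p_univ] h s hs.
have /choice[l lE] := p_surj.
have [|k [a [b [ar ba]]]] := M_factors (h := h \o p) (r := r ++ [seq l x | x <- s]).
  move=> x; rewrite mem_cat => /orP[/pr xp|/mapP[y /hs hy ->]] /=.
    by rewrite xp linear0.
  by rewrite lE.
have [|a' a'E] := p_univ _ a; first by move=> x xr; rewrite ar // mem_cat xr.
exists k, a', b; split=> x.
  by move=> xs; rewrite -[x]lE a'E ar // mem_cat orbC map_f.
by rewrite -[x]lE a'E ba.
Qed.

(* A pair (x, c) is a label of a generator with image x in M; the counter c
   makes an unlimited supply of fresh labels available for each x. *)
Notation label := (M * nat)%type.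

(** An index of the direct system is a module over M with finitely many labelled generators. By
    [lb_gen] a map is determined by its values on them; [lb_val] is arbitrary outside [lb_dom]. *)
Record labelled := Labelled {
  lb_index : K;
  lb_map : {linear X lb_index -> M};
  lb_val : label -> X lb_index;
  lb_dom : seq label;
  lb_valP : forall t, t \in lb_dom -> lb_map (lb_val t) = t.1;
  lb_gen : forall (V : lmodType S) (f g : {linear X lb_index -> V}),
    (forall t, t \in lb_dom -> f (lb_val t) = g (lb_val t)) -> f =1 g
}.

Local Notation obj i := (X (lb_index i)).

Definition labelled_map (i j : labelled) (f : {linear obj i -> obj j}) :=
  forall t, t \in lb_dom i -> t \in lb_dom j /\ f (lb_val i t) = lb_val j t.

Definition labelled_le i j := `[< exists f, @labelled_map i j f >].

HB.instance Definition _ := gen_eqMixin labelled.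
HB.instance Definition _ := gen_choiceMixin labelled.

Fact labelled_le_refl : reflexive labelled_le.
Proof. by move=> i; apply/asboolP; exists idfun. Qed.

Fact labelled_le_trans : transitive labelled_le.
Proof.
move=> j i k /asboolP[f fE] /asboolP[g gE]; apply/asboolP.
exists (g \o f) => t /fE[tj ft]; have [tk gt] := gE t tj.
by split=> //=; rewrite ft.
Qed.

HB.instance Definition _ := @Order.Le_isPreorder.Build (Order.Disp tt tt)
  labelled labelled_le labelled_le_refl labelled_le_trans.

(** This uniqueness turns the labelled modules into a preorder and makes the arbitrarily chosen
    transition maps compatible with composition. *)
Lemma labelled_map_uniq i j (f g : {linear obj i -> obj j}) :
  labelled_map f -> labelled_map g -> f =1 g.
Proof.
by move=> fE gE; apply: lb_gen => t ti; rewrite (fE t ti).2 (gE t ti).2.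
Qed.

Definition transition i j (ij : (i <= j)%O) : {linear obj i -> obj j} :=
  projT1 (cid (asboolW ij)).

Lemma transitionP i j (ij : (i <= j)%O) : labelled_map (transition ij).
Proof. exact: projT2 (cid (asboolW ij)). Qed.

Fact transition_id i (ii : (i <= i)%O) x : transition ii x = x.
Proof. by apply: (labelled_map_uniq (g := idfun)); first exact: transitionP. Qed.

Fact transition_comp i j k (ij : (i <= j)%O) (jk : (j <= k)%O) (ik : (i <= k)%O) x :
  transition jk (transition ij x) = transition ik x.
Proof.
apply: (labelled_map_uniq (f := transition jk \o transition ij)).
  move=> t ti; have [tj ft] := transitionP ij ti; have [tk gt] := transitionP jk tj.
  by split=> //=; rewrite ft.
exact: transitionP.
Qed.

Definition labelled_system : direct_system S labelled :=
  DirectSystem transition_id transition_comp.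

Lemma labelled_cocone : is_cocone (D := labelled_system) lb_map.
Proof.
move=> i j ij; apply: (lb_gen (f := lb_map j \o transition ij)) => t ti /=.
by have [tj ->] := transitionP ij ti; rewrite !lb_valP.
Qed.

(** A prescribed finite labelling is completed by giving the generators of [X k] fresh labels, so
    that [lb_gen] holds. *)
Lemma labelled_ex k (b : {linear X k -> M}) (q : label -> X k) (s : seq label) :
  (forall t, t \in s -> b (q t) = t.1) ->
  exists (i : labelled) (f : {linear X k -> obj i}),
    (forall x, lb_map i (f x) = b x) /\
    forall t, t \in s -> t \in lb_dom i /\ lb_val i t = f (q t).
Proof.
move=> qs; have [n [p [r [p_surj _ _]]]] := finitely_presented_presentation (X_fp k).
(* All counters in [s] are below N, so the new counters [N + l] cannot clash with them. *)
pose N := (\max_(t <- s) t.2).+1.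
(* The generators are indexed by [nat], with value 0 from [n] on, so that [t.2 - N] recovers the
   generator from its label. *)
pose e l : X k := p (if insub l is Some l' then delta_mx 0 l' else 0).
pose new := [seq (b (e l), (N + l)%N) | l <- iota 0 n].
have newP t : t \in s -> (t.2 < N)%N by move=> ts; rewrite ltnS (leq_bigmax_seq _ ts).
pose q' t := if t \in s then q t else e (t.2 - N)%N.
have q'P t : t \in s ++ new -> b (q' t) = t.1.
  rewrite mem_cat /q'; have [/qs//|_] := boolP (t \in s).
  by move=> /mapP[l _ ->] /=; rewrite addKn.
have q'_gen (V : lmodType S) (f g : {linear X k -> V}) :
    (forall t, t \in s ++ new -> f (q' t) = g (q' t)) -> f =1 g.
  move=> fg x; have [y <-] := p_surj x.
  apply: (@linear_rV_eq S n V (f \o p) (g \o p)) => l /=.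
  have el : e l = p (delta_mx 0 l) by rewrite /e valK.
  have := fg (b (e l), (N + l)%N); rewrite /q'.
  have [/newP /=|_] := boolP (_ \in s); first by rewrite ltnNge leq_addr.
  rewrite /= addKn el; apply.
  rewrite mem_cat -el; apply/orP; right; apply/mapP.
  by exists (l : nat); rewrite // mem_iota ltn_ord.
exists (Labelled q'P q'_gen), idfun; split=> // t ts.
by rewrite /= mem_cat /q' ts.
Qed.

(** One construction gives both directedness (with [y = 0]) and the vanishing of kernel elements at
    a later stage. *)
Lemma labelled_amalgam (i j : labelled) (y : obj i) : lb_map i y = 0 ->
  exists k (ik : (i <= k)%O), (j <= k)%O /\ transition ik y = 0.
Proof.
move=> y0.
have [n [p [r pP]]] := finitely_presented_presentation (X_fp (lb_index i)).
have [n' [p' [r' pP']]] := finitely_presented_presentation (X_fp (lb_index j)).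
have [p2 [r2 p2P]] := presentation_prod pP pP'.
have [h hE] : exists h : {linear (obj i * obj j)%type -> M},
    h =1 fun z => lb_map i z.1 + lb_map j z.2.
  by apply: ex_linear => b x z; rewrite !linearP /= scalerDr addrACA.
pose common := [seq t <- lb_dom i | t \in lb_dom j].
(* The map from the direct sum to M kills [y] and the differences of generators with a common label.
   A factorization killing them too makes the two labellings agree in [X k]. *)
have [|k [a [b [as0 ba]]]] := presented_factors p2P (h := h)
    (s := (y, 0) :: [seq (lb_val i t, - lb_val j t) | t <- common]).
  move=> z; rewrite inE => /predU1P[->|/mapP[t]].
    by rewrite hE /= y0 linear0 addr0.
  rewrite mem_filter => /andP[tj ti] ->.
  by rewrite hE /= linearN /= !lb_valP ?subrr.
have [a1 a1E] : exists a1 : {linear obj i -> X k}, a1 =1 fun x => a (x, 0).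
  apply: ex_linear => c x z; rewrite -linearP; congr (a _).
  by congr pair; rewrite //= scaler0 addr0.
have [a2 a2E] : exists a2 : {linear obj j -> X k}, a2 =1 fun x => a (0, x).
  apply: ex_linear => c x z; rewrite -linearP; congr (a _).
  by congr pair; rewrite //= scaler0 addr0.
have a12 t : t \in lb_dom i -> t \in lb_dom j -> a1 (lb_val i t) = a2 (lb_val j t).
  move=> ti tj; apply/subr0_eq; rewrite a1E a2E -linearB.
  have -> : ((lb_val i t, 0) - (0, lb_val j t) : (obj i * obj j)%type) =
    (lb_val i t, - lb_val j t) by congr pair; rewrite /= ?subr0 ?sub0r.
  by apply: as0; rewrite inE map_f ?orbT // mem_filter ti tj.
pose q t := if t \in lb_dom i then a1 (lb_val i t) else a2 (lb_val j t).
have [|l [f [fb fq]]] := labelled_ex (b := b) (q := q) (s := lb_dom i ++ lb_dom j).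
  move=> t; rewrite mem_cat /q; have [ti _|_ /= tj] := boolP (t \in lb_dom i).
    by rewrite a1E ba hE /= linear0 addr0 lb_valP.
  by rewrite a2E ba hE /= linear0 add0r lb_valP.
have fi : labelled_map (f \o a1).
  move=> t ti; have [|tl ->] := fq t; first by rewrite mem_cat ti.
  by split=> //=; rewrite /q ti.
have fj : labelled_map (f \o a2).
  move=> t tj; have [|tl ->] := fq t; first by rewrite mem_cat tj orbT.
  by split=> //=; rewrite /q; case: ifP => // ti; rewrite a12.
have il : (i <= l)%O by apply/asboolP; exists (f \o a1).
have jl : (j <= l)%O by apply/asboolP; exists (f \o a2).
exists l, il; split=> //.
rewrite (labelled_map_uniq (transitionP il) fi) /= a1E as0 ?mem_head //.
exact: linear0.
Qed.

Lemma factors_lim_class (C : module_class S) : (forall k, C (X k)) -> lim_class C M.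
Proof.
move=> CX.
have surj z : exists i x, lb_map i x = z.
  (* An element of M is a map from the free module of rank 1; its factorization through some [X k]
     shows that a labelled module hits it. *)
  have [h hE] := ex_linear_rV (fun _ : 'I_1 => z).
  have [//|k [a [b [_ ba]]]] := M_factors (h := h) (r := [::]).
  have [//|i [f [fb _]]] := labelled_ex (b := b) (q := fun=> 0) (s := [::]).
  by exists i, (f (a (delta_mx 0 ord0))); rewrite fb ba hE.
have dirI : directed labelled.
  split; first by have [i _] := surj 0.
  move=> i j; have [|k [ik [jk _]]] := @labelled_amalgam i j 0.
    exact: linear0.
  by exists k.
exists _, labelled, labelled_system, lb_map; split=> // [i|].
  exact: CX.
apply: is_direct_limitP => //; first exact: labelled_cocone.
move=> i x /(labelled_amalgam i)[k [ik [_ xk]]].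
by exists k, ik.
Qed.

End Lenzing.

(** * Direct limits of modules of projective dimension at most one *)

Lemma short_exact_ex (S : pzRingType) p q (f : {linear 'rV[S]_p -> 'rV[S]_q}) :
  injective f -> exists (X : lmodType S) (g : {linear 'rV[S]_q -> X}), short_exact f g.
Proof.
move=> f_inj.
have [|X [g [g_surj gE]]] := @quotient_ex S 'rV[S]_q (fun y => exists x, f x = y).
  split=> [|a _ _ [x <-] [y <-]]; first by exists 0; rewrite linear0.
  by exists (a *: x + y); rewrite linearP.
by exists X, g; split.
Qed.

(** A small index type for Lenzing's criterion: each map stands for its cokernel, so the direct
    system is not indexed by a class of modules. *)
Record rV_injection (S : pzRingType) := RVInjection {
  ri_dom : nat;
  ri_codom : nat;
  ri_map : {linear 'rV[S]_ri_dom -> 'rV[S]_ri_codom};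
  ri_inj : injective ri_map
}.

Lemma lim_class_dim_le1 (S : pzRingType) (M : lmodType S) :
  lim_class (dim_le1 (@projective S)) M ->
  lim_class (fun X => finitely_presented X /\ dim_le1 (@projective S) X) M.
Proof.
move=> limM.
have /choice[X X_exact] (k : rV_injection S) := short_exact_ex (@ri_inj _ k).
have X_fp k : finitely_presented (X k).
  have [g [_ fg g_surj]] := X_exact k.
  by exists (ri_dom k), (ri_codom k), (ri_map k), g.
apply: (factors_lim_class (X := X)) => // [n h r hr|k].
  have [Z [a [b [Z1 ar ba]]]] := lim_class_factors limM hr.
  have [p [q [f [f_inj fX]]]] := dim_le1_factors Z1 ar.
  have [g exact_g] := X_exact (RVInjection f_inj).
  have [a' [b' [a'r b'a']]] := fX _ g exact_g.
  by exists (RVInjection f_inj), a', (b \o b'); split=> // x /=; rewrite b'a' ba.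
split=> //; have [g exact_g] := X_exact k.
exists 'rV[S]_(ri_dom k), 'rV[S]_(ri_codom k), (ri_map k), g.
by split=> //; apply: projective_rV.
Qed.

Lemma lim_class_const (S : pzRingType) (C : module_class S) M : C M -> lim_class C M.
Proof.
move=> CM.
pose D : direct_system S nat := @DirectSystem S _ nat (fun=> M)
  (fun _ _ _ => idfun) (fun _ _ _ => erefl) (fun _ _ _ _ _ _ _ => erefl).
exists _, nat, D, (fun=> idfun); split=> //.
  split=> [|i j]; first exact: (inhabits 0).
  by exists (maxn i j); rewrite !leEnat leq_maxl leq_maxr.
split=> // N v v_coc; exists (v 0); split=> [i x|h' h'E x]; last exact: (h'E 0).
exact/esym/(v_coc 0 i (leq0n i)).
Qed.

Lemma lim_class_sub (S : pzRingType) (C C' : module_class S) M :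
  (forall X, C X -> C' X) -> lim_class C M -> lim_class C' M.
Proof.
move=> CC' [d [I [D [u [dirI CD limu]]]]]; exists d, I, D, u; split=> // i.
exact: CC'.
Qed.

(** Factoring the presentation map [p] through a term N of the system and descending to M splits the
    identity of M through N. *)
Lemma finitely_presented_lim_retract (S : pzRingType) (C : module_class S) M :
  finitely_presented M -> lim_class C M ->
  exists (N : lmodType S) (s : {linear M -> N}) (r : {linear N -> M}), C N /\ cancel s r.
Proof.
move=> /finitely_presented_presentation[n [p [r [p_surj pr p_univ]]]].
move=> /lim_class_factors/(_ n p r pr)[N [a [b [CN ar ba]]]].
have [s sE] := p_univ N a ar; exists N, s, b; split=> // x.
by have [y <-] := p_surj x; rewrite sE ba.
Qed.

Theorem corollary2p8 (R : pzRingType) :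
  same_class (lim_class (@P1 R)) (@F1 R) ->
  same_class (lim_class (@F1fp R)) (@F1 R).
Proof.
move=> limP1 M; split=> [limM|/limP1/lim_class_dim_le1].
  apply/limP1; apply: lim_class_sub limM => X [X_fp /limP1 X_lim].
  have [N [s [r [N1 sK]]]] := finitely_presented_lim_retract X_fp X_lim.
  exact: dim_le1_retract sK N1.
apply: lim_class_sub => X [X_fp X1]; split=> //.
exact/limP1/lim_class_const.
Qed.
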